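(* Suppose that $M$ is a countable $\omega$-categorical Ramsey structure. Then there are two models $M_0,M_1$, both isomorphic to $M$ and contained in $M$, such that $M_0\downarrow^{ns}M_1$ and $M_1\downarrow^{ns}M_0$.
   Context: The language is countable. A countable structure $M$ is ultrahomogeneous if every isomorphism between two finitely generated substructures of $M$ extends to an automorphism of $M$. $\mathrm{Age}(M)$ is the class of finitely generated structures which embed into $M$. For structures $A,B$, $\binom{B}{A}$ is the set of substructures of $B$ isomorphic to $A$. A class $K$ of finite structures is a Ramsey class if for all $A,B\in K$ and $k<\omega$ there is $C\in K$ such that for every function $f:\binom{C}{A}\to k$ there is $B'\in\binom{C}{B}$ such that $f$ is constant on $\binom{B'}{A}$. A Ramsey structure is an ultrahomogeneous structure $M$ with a quantifier-free definable linear order such that $\mathrm{Age}(M)$ is a Ramsey class. For subsets (or tuples) $A,B$ of $M$, $A\downarrow^{ns}B$ means that the type of (an enumeration of) $A$ over $B$, computed in $M$, does not split over $\emptyset$: whenever $b',b''$ are finite tuples from $B$ with $\mathrm{tp}(b'/\emptyset)=\mathrm{tp}(b''/\emptyset)$, then $\mathrm{tp}(b'/A)=\mathrm{tp}(b''/A)$. *)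

(* Defs.v *)
From mathcomp Require Import all_boot.
From mathcomp Require Import boolp classical_sets functions cardinality.

Set Implicit Arguments.
Unset Strict Implicit.
Unset Printing Implicit Defensive.

Local Open Scope classical_set_scope.

Record language := Language {
  Fun : Type;
  Rel : Type;
  fun_arity : Fun -> nat;
  rel_arity : Rel -> nat }.

Definition countable_language (L : language) : Prop :=
  countable [set: Fun L] /\ countable [set: Rel L].

(* Constants are 0-ary function symbols, and the carrier may be empty. *)
Record structure (L : language) := Structure {
  carrier :> Type;
  fun_interp : forall f : Fun L, ('I_(fun_arity f) -> carrier) -> carrier;
  rel_interp : forall r : Rel L, ('I_(rel_arity r) -> carrier) -> Prop }.

Section Maps.
Variable L : language.

Definition embedding (M N : structure L) (h : M -> N) : Prop :=
  [/\ injective h,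
      forall (f : Fun L) v, h (fun_interp (f := f) v) = fun_interp (h \o v) &
      forall (r : Rel L) v, rel_interp (r := r) v <-> rel_interp (r := r) (h \o v)].

Definition embeds (M N : structure L) : Prop := exists h : M -> N, embedding h.

Definition isomorphism (M N : structure L) (h : M -> N) : Prop :=
  embedding h /\ bijective h.

Definition isomorphic (M N : structure L) : Prop :=
  exists h : M -> N, isomorphism h.

Record substructure (M : structure L) := Substructure {
  sub_dom :> set M;
  sub_closed : forall (f : Fun L) (v : 'I_(fun_arity f) -> M),
    (forall i, sub_dom (v i)) -> sub_dom (fun_interp v) }.

Definition induced (M : structure L) (S : substructure M) : structure L :=
  @Structure L (set_type S)
    (fun f v => SigSub (mem_set
       (@sub_closed M S f (fun i => val (v i)) (fun i => set_valP (v i)))))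
    (fun r v => rel_interp (r := r) (fun i => val (v i))).

Definition finitely_generated (M : structure L) : Prop :=
  exists2 X : set M, finite_set X &
    forall S : substructure M, X `<=` S -> sub_dom S = setT.

Definition age (M N : structure L) : Prop :=
  finitely_generated N /\ embeds N M.

Definition ultrahomogeneous (M : structure L) : Prop :=
  forall A B : substructure M,
    finitely_generated (induced A) -> finitely_generated (induced B) ->
    forall h : induced A -> induced B, isomorphism h ->
    exists2 g : M -> M, isomorphism g &
      forall a : induced A, g (val a) = val (h a).

Definition copies (B A : structure L) : set (substructure B) :=
  [set S | isomorphic (induced S) A].
Arguments copies : clear implicits.

(* For B' a substructure of C, the copies of A in B' are the copies of A in C
   that are included in B'. *)
Definition ramsey_class (K : structure L -> Prop) : Prop :=
  (forall A, K A -> finite_set [set: A]) /\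
  (forall A B, K A -> K B -> forall k : nat,
     exists2 C, K C &
       forall f : copies C A -> 'I_k,
         exists2 B' : substructure C, copies C B B' &
           forall X Y : copies C A,
             val X `<=` B' -> val Y `<=` B' -> f X = f Y).

End Maps.

Arguments copies {L} B A _.

Section Logic.
Variable L : language.

(* Terms and formulas whose free variables are among the n variables 'I_n. *)
Inductive term (n : nat) : Type :=
| Var of 'I_n
| App (f : Fun L) of ('I_(fun_arity f) -> term n).

(* In Forall phi the bound variable is the variable ord0 of phi. *)
Inductive formula : nat -> Type :=
| Bot n : formula n
| Eq n of term n & term n : formula n
| Atom n (r : Rel L) of ('I_(rel_arity r) -> term n) : formula n
| Imp n of formula n & formula n : formula n
| Forall n of formula n.+1 : formula n.

Fixpoint quantifier_free n (phi : formula n) : bool :=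
  match phi with
  | Bot _ | Eq _ _ _ | Atom _ _ _ => true
  | Imp _ p q => quantifier_free p && quantifier_free q
  | Forall _ _ => false
  end.

Definition vnil {T : Type} (i : 'I_0) : T := False_rect T (notF (ltn_ord i)).

Definition vcons {T : Type} n (x : T) (v : 'I_n -> T) (i : 'I_n.+1) : T :=
  if unlift ord0 i is Some j then v j else x.

Definition vcat {T : Type} m n (v : 'I_m -> T) (w : 'I_n -> T)
    (i : 'I_(m + n)) : T :=
  match fintype.split i with inl j => v j | inr k => w k end.

Fixpoint eval (M : structure L) n (v : 'I_n -> M) (t : term n) : M :=
  match t with
  | Var i => v i
  | App f ts => fun_interp (fun i => eval v (ts i))
  end.

Fixpoint sat (M : structure L) n (phi : formula n) : ('I_n -> M) -> Prop :=
  match phi with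
  | Bot _ => fun _ => False
  | Eq _ t u => fun v => eval v t = eval v u
  | Atom _ r ts => fun v => rel_interp (r := r) (fun i => eval v (ts i))
  | Imp _ p q => fun v => sat p v -> sat q v
  | Forall _ p => fun v => forall x : M, sat p (vcons x v)
  end.

Definition elementarily_equivalent (M N : structure L) : Prop :=
  forall phi : formula 0, sat (M := M) phi vnil <-> sat (M := N) phi vnil.

(* The theory of M has only one countable model up to isomorphism; finite M
   satisfy this trivially. *)
Definition omega_categorical (M : structure L) : Prop :=
  forall N : structure L, countable [set: N] ->
    elementarily_equivalent N M -> isomorphic N M.

Definition strict_linear_order (T : Type) (lt : T -> T -> Prop) : Prop :=
  [/\ forall x, ~ lt x x,
      forall x y z, lt x y -> lt y z -> lt x z &
      forall x y, [\/ lt x y, x = y | lt y x]].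

Definition qf_definable_order (M : structure L) : Prop :=
  exists2 phi : formula 2, quantifier_free phi &
    strict_linear_order (fun x y : M => sat phi (vcons x (vcons y vnil))).

Definition ramsey_structure (M : structure L) : Prop :=
  [/\ ultrahomogeneous M, qf_definable_order M & ramsey_class (age M)].

(* A formula in n free variables with parameters from C: a tuple c of m
   parameters and a formula whose first m variables stand for c. *)
Definition param_formula (M : structure L) (C : set M) (n : nat) : Type :=
  {m : nat & (('I_m -> C) * formula (m + n))%type}.

Definition tp (M : structure L) (C : set M) n (b : 'I_n -> M) :
    set (param_formula C n) :=
  [set p | sat (projT2 p).2 (vcat (fun i => val ((projT2 p).1 i)) b)].
Arguments tp {M} C {n} b _.

Definition nonsplit (M : structure L) (A B : set M) : Prop :=
  forall n (b b' : 'I_n -> M), (forall i, B (b i)) -> (forall i, B (b' i)) ->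
    tp set0 b = tp set0 b' -> tp A b = tp A b'.

End Logic.

Arguments tp {L M} C {n} b _.

(* Main.v *)
(** By ultrahomogeneity, tuples with the same type are conjugate under Aut(M), and
    rigidity of finite substructures (they are linearly ordered) turns the Ramsey
    property into a statement about automorphisms: for a finite set [S] and finitely
    many automorphisms [tau_j] there is a finite set [D] such that, for every finite
    colouring [c] of Aut(M) depending only on the restriction to [S], some [r] mapping
    [S] into [D] satisfies [c (r tau_j) = c r] for all [j]. The set [D] depends on the
    number of colours but not on the colouring.

    Given finitely many formulas [theta_j (s, r)] in the restrictions of two
    automorphisms to [S], let [D] be the set for the colourings
    [s |-> {j | theta_j (s, r)}]. First choose [r] for the colouring by the truth values
    of all [theta_j (s, r)] with [s] mapping [S] into [D]; then choose [s] with values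
    in [D] for the colouring determined by this [r]. Then [theta_j (s, r)],
    [theta_j (s, r tau_j)] and [theta_j (s tau_j, r)] are equivalent, which is finite
    nonsplitting in both directions. An ultraproduct of such pairs [(s, r)] gives two
    elementary maps of [M] into a countable structure elementarily equivalent to [M],
    hence isomorphic to it; their ranges are the two models. *)
Require Import Defs.
From mathcomp Require Import all_boot finmap.
From mathcomp Require Import boolp classical_sets functions cardinality filter.

Set Implicit Arguments.
Unset Strict Implicit.
Unset Printing Implicit Defensive.

Local Open Scope classical_set_scope.

Lemma inj_surj_bijective (T U : Type) (h : T -> U) :
  injective h -> (forall y, exists x, h x = y) -> bijective h.
Proof.
move=> h_inj /choice[g gK]; exists g => // x.
by apply: h_inj; rewrite gK.
Qed.

(** * Embeddings, induced substructures and satisfaction *)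

Section Embeddings.
Variable L : language.

Lemma embedding_comp (M N P : structure L) (g : N -> P) (h : M -> N) :
  embedding g -> embedding h -> embedding (g \o h).
Proof.
move=> [g_inj gF gR] [h_inj hF hR]; split; first exact: inj_comp.
- by move=> f v /=; rewrite hF gF.
- by move=> r v; rewrite hR gR.
Qed.

Lemma isomorphism_comp (M N P : structure L) (g : N -> P) (h : M -> N) :
  isomorphism g -> isomorphism h -> isomorphism (g \o h).
Proof.
move=> [ge gb] [he hb]; split; first exact: embedding_comp.
exact: bij_comp.
Qed.

Lemma isomorphism_inv (M N : structure L) (h : M -> N) :
  isomorphism h -> exists g : N -> M, [/\ isomorphism g, cancel h g & cancel g h].
Proof.
move=> [[h_inj hF hR] [g hK gK]]; exists g; split=> //; split; last by exists h.
split; first exact: can_inj gK.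
- by move=> f v; apply: h_inj; rewrite gK hF; congr fun_interp; apply/funext => i /=.
- move=> r v; rewrite hR; suff -> : h \o (g \o v) = v by [].
  by apply/funext => i /=.
Qed.

Lemma isomorphism_id (M : structure L) : isomorphism (@id M).
Proof. by split; [split|exists id]. Qed.

Lemma embedding_val (M : structure L) (S : substructure M) :
  embedding (val : induced S -> M).
Proof. by split=> //; apply: val_inj. Qed.

Lemma embedding_restrict (M N : structure L) (e : M -> N) (S : substructure M)
    (T : substructure N) :
  embedding e -> (forall x, sub_dom S x -> sub_dom T (e x)) ->
  exists2 h : induced S -> induced T, embedding h & forall x, val (h x) = e (val x).
Proof.
move=> [e_inj eF eR] ST.
exists (fun x => SigSub (mem_set (ST _ (set_valP x)))) => //; split.
- by move=> x y /(congr1 val)/= /e_inj/val_inj.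
- by move=> f v; apply: val_inj; rewrite /= eF.
- by move=> r v; rewrite /= eR.
Qed.

Lemma embedding_range (M N : structure L) (e : M -> N) : embedding e ->
  exists2 T : substructure N, sub_dom T = range e &
    exists2 h : M -> induced T, isomorphism h & forall x, val (h x) = e x.
Proof.
move=> ee; have [e_inj eF eR] := ee.
have cl (f : Defs.Fun L) (v : 'I_(fun_arity f) -> N) :
    (forall i, range e (v i)) -> range e (fun_interp v).
  move=> vP; have /choice[w wv] i : exists x, e x = v i.
    by have [x _ <-] := vP i; exists x.
  by exists (fun_interp w) => //; rewrite eF; congr fun_interp; apply/funext.
exists (Substructure cl) => //.
have rP x : range e (e x) by exists x.
exists (fun x => SigSub (mem_set (rP x))) => //; split; first split.
- by move=> x y /(congr1 val)/= /e_inj.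
- by move=> f v; apply: val_inj; rewrite /= eF.
- by move=> r v; rewrite /= eR.
- apply: inj_surj_bijective => [x y /(congr1 val)/= /e_inj//|y].
  by have [x _ xy] := set_valP y; exists x; apply: val_inj.
Qed.

Lemma eval_embedding (M N : structure L) (e : M -> N) n (v : 'I_n -> M) (t : term L n) :
  embedding e -> e (eval v t) = eval (e \o v) t.
Proof.
move=> [_ eF _]; elim: t => [//|f ts IH] /=.
by rewrite eF; congr fun_interp; apply/funext => i /=.
Qed.

Lemma comp_vcons (T U : Type) (h : T -> U) n (x : T) (v : 'I_n -> T) :
  h \o vcons x v = vcons (h x) (h \o v).
Proof. by apply/funext => i; rewrite /vcons /=; case: unlift. Qed.

Lemma comp_vcat (T U : Type) (h : T -> U) m n (v : 'I_m -> T) (w : 'I_n -> T) :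
  h \o vcat v w = vcat (h \o v) (h \o w).
Proof. by apply/funext => i; rewrite /vcat /=; case: fintype.split. Qed.

Lemma sat_isomorphism (M N : structure L) (h : M -> N) n (phi : formula L n) (v : 'I_n -> M) :
  isomorphism h -> sat phi v <-> sat phi (h \o v).
Proof.
move=> [he [g hK gK]]; have [h_inj hF hR] := he.
elim: phi v => {n} [//|n t u|n r ts|n p IHp q IHq|n p IHp] v /=.
- by rewrite -!eval_embedding//; split=> [->|/h_inj].
- rewrite hR; suff -> : h \o (fun i => eval v (ts i)) = (fun i => eval (h \o v) (ts i)) by [].
  by apply/funext => i /=; rewrite eval_embedding.
- by rewrite IHp IHq.
- split=> [vP y|vP x]; first by rewrite -(gK y) -comp_vcons -IHp.
  by rewrite IHp comp_vcons.
Qed.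

End Embeddings.

(** * Automorphisms and generated substructures *)

Section Ages.
Variables (L : language) (M : structure L).

Definition aut (s : M -> M) : Prop := isomorphism s.

Lemma sat_aut n (phi : formula L n) s (v : 'I_n -> M) :
  aut s -> sat phi v <-> sat phi (s \o v).
Proof. exact: sat_isomorphism. Qed.

Lemma finite_finitely_generated (N : structure L) :
  finite_set [set: N] -> finitely_generated N.
Proof. by move=> fN; exists setT => // S; rewrite subTset. Qed.

(** Ultrahomogeneity applies to the isomorphism between the two ranges, which are finite and hence
    finitely generated. *)
Lemma finite_embeddings_conjugate (N : structure L) (e i : N -> M) :
  ultrahomogeneous M -> finite_set [set: N] -> embedding i -> embedding e ->
  exists2 g : M -> M, aut g & forall x, g (i x) = e x.
Proof.
move=> hom fN /embedding_range[S _ [hi ihi vhi]] /embedding_range[T _ [he ihe vhe]].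
have [gi [igi hiK giK]] := isomorphism_inv ihi.
have fg (X : substructure M) (h : N -> induced X) : isomorphism h ->
    finitely_generated (induced X).
  move=> [_ [g hK gK]]; apply: finite_finitely_generated.
  apply: (@sub_finite_set _ _ (h @` setT)); last exact: finite_image.
  by move=> x _; exists (g x).
have [g ag gP] := hom S T (fg _ _ ihi) (fg _ _ ihe) _ (isomorphism_comp ihe igi).
by exists g => // x; rewrite -vhi gP /= hiK vhe.
Qed.

Lemma gen_closed (S : set M) (f : Defs.Fun L) (v : 'I_(fun_arity f) -> M) :
  (forall i, (\bigcap_(T in [set T : substructure M | S `<=` T]) sub_dom T) (v i)) ->
  (\bigcap_(T in [set T : substructure M | S `<=` T]) sub_dom T) (fun_interp v).
Proof. by move=> vP T ST; apply: sub_closed => i; apply: vP. Qed.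

Definition gen (S : set M) : substructure M := Substructure (@gen_closed S).

Lemma sub_gen (S : set M) : S `<=` gen S.
Proof. by move=> x Sx T; apply. Qed.

Lemma gen_min (S : set M) (T : substructure M) : S `<=` T -> gen S `<=` T.
Proof. by move=> ST x; apply. Qed.

(** A substructure [T] of [induced (gen S)] is pushed forward to [M], where minimality of [gen S]
    applies. *)
Lemma gen_finitely_generated (S : set M) :
  finite_set S -> finitely_generated (induced (gen S)).
Proof.
move=> fS; exists [set x | S (val x)].
  by apply: finite_preimage => // x y _ _; apply: val_inj.
move=> T ST; have cl (f : Defs.Fun L) (v : 'I_(fun_arity f) -> M) :
    (forall i, (val @` sub_dom T) (v i)) -> (val @` sub_dom T) (fun_interp v).
  move=> vP; have /choice[w wv] i : exists x, sub_dom T x /\ val x = v i.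
    by have [x Tx <-] := vP i; exists x.
  exists (fun_interp w); first by apply: sub_closed => i; have [] := wv i.
  by rewrite /=; congr fun_interp; apply/funext => i; have [] := wv i.
apply/seteqP; split=> // x _.
have /= := @gen_min S (Substructure cl) _ _ (set_valP x).
case=> [y Sy|y Ty /val_inj <- //].
exists (SigSub (mem_set (sub_gen Sy))) => //.
by apply: ST.
Qed.

Lemma gen_age (S : set M) : finite_set S -> age M (induced (gen S)).
Proof.
move=> fS; split; first exact: gen_finitely_generated.
by exists val; apply: embedding_val.
Qed.

Lemma gen_range_eval n (b : 'I_n -> M) x :
  sub_dom (gen (range b)) x -> exists t : term L n, eval b t = x.
Proof.
have cl (f : Defs.Fun L) (v : 'I_(fun_arity f) -> M) :
    (forall i, range (@eval L M n b) (v i)) -> range (@eval L M n b) (fun_interp v).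
  move=> vP; have /choice[ts tv] i : exists t, eval b t = v i.
    by have [t _ <-] := vP i; exists t.
  by exists (App ts) => //=; congr fun_interp; apply/funext.
have sub : range b `<=` Substructure cl by move=> _ [i _ <-]; exists (Var L i).
by move/(gen_min sub) => [t _ <-]; exists t.
Qed.

Lemma gen_image (s : M -> M) (S T : set M) :
  embedding s -> (forall x, S x -> T (s x)) ->
  forall x, sub_dom (gen S) x -> sub_dom (gen T) (s x).
Proof.
move=> [_ sF _] ST.
have cl (f : Defs.Fun L) (v : 'I_(fun_arity f) -> M) :
    (forall i, sub_dom (gen T) (s (v i))) -> sub_dom (gen T) (s (fun_interp v)).
  by move=> vP; rewrite sF; apply: sub_closed.
apply: (@gen_min S (Substructure (sub_dom := [set x | sub_dom (gen T) (s x)]) cl)).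
by move=> x /ST /sub_gen.
Qed.

End Ages.

(** * Conjugacy of tuples, rigidity, and the Ramsey property for automorphisms *)

Section Ramsey.
Variables (L : language) (M : structure L).

Lemma vcat0 T n (v : 'I_0 -> T) (w : 'I_n -> T) : vcat v w = w.
Proof.
apply/funext => i; rewrite /vcat; case: splitP => [[]//|k ik].
by congr w; apply: val_inj.
Qed.

Lemma tp_set0_sat n (b b' : 'I_n -> M) (phi : formula L n) :
  tp set0 b = tp set0 b' -> sat phi b <-> sat phi b'.
Proof.
move=> bb'; pose p : param_formula (set0 : set M) n :=
  existT _ 0 (@vnil _, phi : formula L (0 + n)).
by have := congr1 (@^~ p) bb'; rewrite /tp /= !vcat0 => ->.
Qed.

(** Equivalence on equations makes the map from values of terms at [b] to their values at [b'] well
    defined and injective; with equivalence on atoms it embeds the finite substructure generated by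
    [b]. *)
Lemma tp_aut n (b b' : 'I_n -> M) :
  ultrahomogeneous M -> (forall N, age M N -> finite_set [set: N]) ->
  (forall phi : formula L n, sat phi b <-> sat phi b') ->
  exists2 s, aut s & s \o b = b'.
Proof.
move=> hom fage satE.
have eqE (t u : term L n) : eval b t = eval b u <-> eval b' t = eval b' u.
  exact: (satE (Eq t u)).
have relE r (ts : 'I_(rel_arity r) -> term L n) := satE (Atom ts).
have /choice[t tP] (x : induced (gen (range b))) : exists t : term L n, eval b t = val x.
  exact/gen_range_eval/set_valP.
have [||s sa sP] := @finite_embeddings_conjugate _ _ (induced (gen (range b)))
    (fun x => eval b' (t x)) val hom _ (embedding_val _).
- by apply/fage/gen_age/finite_image.
- split.
  + by move=> x y /eqE; rewrite !tP => /val_inj.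
  + move=> f v; have /eqE -> // : eval b (t (fun_interp v)) = eval b (App (t \o v)).
    by rewrite tP /=; congr fun_interp; apply/funext => i; rewrite /= tP.
  + move=> r v; have /= <- := relE r (t \o v).
    suff -> : (fun i => eval b ((t \o v) i)) = (fun i => val (v i)) by [].
    by apply/funext => i /=.
- exists s => //; apply/funext => i /=.
  have gi : sub_dom (gen (range b)) (b i) by apply: sub_gen; exists i.
  have := sP (SigSub (mem_set gi)); rewrite /= => ->.
  by have /eqE/= -> : eval b (t (SigSub (mem_set gi))) = eval b (Var L i) by rewrite tP.
Qed.

(** If [w x] differed from [x], the iterates of [w] at [x] would be strictly monotone, hence
    pairwise distinct, inside the finite set [A]. *)
Lemma monotone_on_finite_eq (T : Type) (lt : T -> T -> Prop) (w : T -> T) (A : set T) :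
  strict_linear_order lt -> {homo w : x y / lt x y} ->
  finite_set A -> (forall x, A x -> A (w x)) -> forall x, A x -> w x = x.
Proof.
move=> [ltxx lt_tr lt_tot] w_homo fA wA x Ax.
(* Stated for a general [R], to cover both [lt] and its converse. *)
have inf (R : T -> T -> Prop) : (forall y, ~ R y y) ->
    (forall y z u, R y z -> R z u -> R y u) -> {homo w : y z / R y z} -> ~ R x (w x).
  move=> Rxx R_tr Rw Rxw; apply: infinite_nat.
  have Rk k : R (iter k w x) (iter k.+1 w x) by elim: k => //= k; apply: Rw.
  have Rkd k d : R (iter k w x) (iter (d.+1 + k) w x).
    by elim: d => [|d IH]; [apply: Rk|apply: R_tr IH (Rk _)].
  rewrite (_ : setT = (fun k => iter k w x) @^-1` A).
    apply: finite_preimage => // i j _ _; wlog ij : i j / i < j.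
      move=> H; have [/H//|/H + /esym E|//] := ltngtP i j.
      by move/(_ E).
    have := Rkd i (j - i.+1); rewrite subnSK // (subnK (ltnW ij)) => + E.
    by rewrite -E => /Rxx.
  by apply/seteqP; split=> // k _ /=; elim: k => //= k; apply: wA.
have [xw|//|wx] := lt_tot x (w x); first by have := inf lt ltxx lt_tr w_homo xw.
by have [] := inf (fun y z => lt z y) ltxx (fun y z u zy uz => lt_tr _ _ _ uz zy)
  (fun y z => w_homo z y) wx.
Qed.

(* The linear order makes finite substructures rigid, so that an automorphism is
   determined on a finite set by the image of that set. *)
Lemma aut_eq_on_finite (s s' : M -> M) (A : set M) :
  qf_definable_order M -> aut s -> aut s' -> finite_set A ->
  s @` A = s' @` A -> forall x, A x -> s x = s' x.
Proof.
move=> [phi _ slo] sa sa' fA ss' x Ax.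
have [g [ga gK Kg]] := isomorphism_inv sa.
have wa : aut (g \o s') by apply: isomorphism_comp.
suff : g (s' x) = x by move/(congr1 s); rewrite Kg.
apply: (@monotone_on_finite_eq _ _ (g \o s') A slo) => //.
- move=> y z /=; rewrite (sat_aut _ _ wa) !comp_vcons.
  suff -> : (g \o s') \o vnil = vnil by [].
  by apply/funext => -[].
- move=> y Ay; have [z Az zy] : (s @` A) (s' y) by rewrite ss'; exists y.
  by rewrite /= -zy gK.
Qed.

Definition agree (S : set M) (s s' : M -> M) := forall x, S x -> s x = s' x.

(** A copy of [gen S] in a Ramsey witness [C] gets the colour under [c] of an automorphism carrying
    [gen S] onto its image in [M]; by rigidity the choice of automorphism does not matter. The
    larger structure is generated by [S] and its images under the [tau j]. *)
Lemma ramsey_aut (S : set M) (J K : finType) (tau : J -> M -> M) :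
  ramsey_structure M -> finite_set S -> (forall j, aut (tau j)) ->
  exists2 D : set M, finite_set D &
    forall c : (M -> M) -> K,
      (forall s s', aut s -> aut s' -> agree S s s' -> c s = c s') ->
      exists r, [/\ aut r, forall x, S x -> D (r x) & forall j, c (r \o tau j) = c r].
Proof.
move=> [hom qfo [fage ram]] fS taua.
(* [None] stands for the identity, so that [r] itself is compared with each [r \o tau j]. *)
pose tau' (o : option J) := if o is Some j then tau j else id.
have taua' o : aut (tau' o) by case: o => [j|]; [apply: taua|apply: isomorphism_id].
pose T := \bigcup_o (tau' o @` S).
have fT : finite_set T.
  by apply: bigcup_finite => [|o _]; [apply: finite_finset|apply: finite_image].
pose A := gen S; pose B := gen T.
have AB o x : sub_dom A x -> sub_dom B (tau' o x).
  apply: gen_image; first by have [] := taua' o.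
  by move=> y Sy; exists o => //; exists y.
have [C [Cfg [eC eCe]] CR] := ram _ _ (gen_age fS) (gen_age fT) #|K|.
(* [D] is fixed together with [C], before the colouring [c] is given. *)
exists (range eC); first by apply/finite_image/fage; split=> //; exists eC.
move=> c cS.
have fA : finite_set (sub_dom A).
  have := fage _ (gen_age fS) => /(finite_image val); apply: sub_finite_set.
  by move=> x Ax; exists (SigSub (mem_set Ax)).
(* The default is [id]; below, only sets [X] for which such an automorphism exists are
   considered. *)
have /choice[pick pickP] (X : set C) : exists s : M -> M,
    (exists2 s' : M -> M, aut s' & s' @` A = eC @` X) -> aut s /\ s @` A = eC @` X.
  have [[s sa sX]|nX] := pselect (exists2 s' : M -> M, aut s' & s' @` A = eC @` X).
    by exists s.
  by exists id => /nX.
have [B' [k ik] B'P] := CR (fun X => enum_rank (c (pick (sub_dom (val X))))).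
have [k' [[k'e _] kK k'K]] := isomorphism_inv ik.
have ee : embedding (eC \o val \o k').
  exact/embedding_comp/k'e/embedding_comp/embedding_val.
have [r ra rP] := finite_embeddings_conjugate hom (fage _ (gen_age fT)) (embedding_val _) ee.
(* The image of [A] under [r \o tau' o] comes from a copy of [A] inside [B'], so all the colours
   [c (r \o tau' o)] coincide. *)
have copyP o : exists2 X : copies C (induced A), sub_dom (val X) `<=` sub_dom B' &
    c (pick (sub_dom (val X))) = c (r \o tau' o).
  have [q qe qP] := embedding_restrict (proj1 (taua' o)) (AB o).
  have [X XE [h ih _]] :=
    embedding_range (embedding_comp (embedding_val B') (embedding_comp k'e qe)).
  have [h' [ih' _ _]] := isomorphism_inv ih.
  have cX : copies C (induced A) X by exists h'.
  exists (SigSub (mem_set cX)); rewrite /= XE.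
    by move=> y [x _ <-]; apply: set_valP.
  have XP : (r \o tau' o) @` A = eC @` range (val \o (k' \o q)).
    apply/seteqP; split=> [z [x Ax <-]|z [_ [y _ <-] <-]].
      exists (val (k' (q (SigSub (mem_set Ax))))); first by exists (SigSub (mem_set Ax)).
      by rewrite -[LHS]rP qP.
    by exists (val y); [apply: set_valP|rewrite /= -qP rP].
  have ro : aut (r \o tau' o) by exact: (isomorphism_comp ra (taua' o)).
  have [pa pX] := pickP _ (ex_intro2 _ _ _ ro XP).
  apply: cS => // x /sub_gen Ax.
  by apply: (aut_eq_on_finite qfo) Ax => //; rewrite pX XP.
exists r; split=> //.
  move=> x Sx; have Bx : sub_dom B x by apply: (AB None); apply: sub_gen.
  have := rP (SigSub (mem_set Bx)); rewrite /= => ->.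
  by exists (val (k' (SigSub (mem_set Bx)))).
move=> j; have [X XB' <-] := copyP (Some j); have [Y YB' <-] := copyP None.
by apply: enum_rank_inj; apply: B'P.
Qed.

End Ramsey.

Lemma finite_set_range T (A : set T) :
  finite_set A -> exists n (d : 'I_n -> T), A = range d.
Proof.
elim/Pchoice: T => T in A * => /finite_seqP[s ->].
exists (size s), (tnth (in_tuple s)); apply/seteqP; split=> [x xs|_ [i _ <-]].
  by have /tnthP[i ->] : x \in in_tuple s by []; exists i.
exact: mem_tnth.
Qed.

(** * Pairs of automorphisms absorbing local tests *)

Section TwoAutomorphisms.
Variables (L : language) (M : structure L).
Hypothesis M_ramsey : ramsey_structure M.

(** One implication suffices, since agreement on [S] is symmetric. *)
Definition local (test : (M -> M) -> (M -> M) -> Prop) : Prop :=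
  exists2 S : set M, finite_set S &
    forall s s' r r', agree S s s' -> agree S r r' -> test s r -> test s' r'.

(** Composition is on the right: [tau] moves a tuple of [M] to a conjugate one before [p.1] or [p.2]
    acts. *)
Definition absorbs (test : (M -> M) -> (M -> M) -> Prop) (tau : M -> M)
    (p : (M -> M) * (M -> M)) : Prop :=
  [/\ aut p.1, aut p.2, test p.1 (p.2 \o tau) <-> test p.1 p.2 &
    test (p.1 \o tau) p.2 <-> test p.1 p.2].

Lemma finite_absorption (J : finType) test (tau : J -> M -> M) :
  (forall j, local (test j)) -> (forall j, aut (tau j)) ->
  exists p, forall j, absorbs (test j) (tau j) p.
Proof.
move=> testl taua.
have /choice[S_ SP] j : exists S, finite_set S /\ forall s s' r r' : M -> M,
    agree S s s' -> agree S r r' -> test j s r -> test j s' r'.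
  by have [S fS SP] := testl j; exists S.
pose S := \bigcup_j S_ j.
have fS : finite_set S.
  by apply: bigcup_finite => [|j _]; [apply: finite_finset|have [] := SP j].
have testP j s s' r r' : agree S s s' -> agree S r r' -> test j s r -> test j s' r'.
  move=> ss' rr'; have [_ H] := SP j; apply: H => x Sx; [apply: ss'|apply: rr']; by exists j.
have agree_sym s s' : agree S s s' -> agree S s' s by move=> ss' x /ss'.
have agree_refl s : agree S s s by [].
have [D fD DP] := @ramsey_aut _ _ S _ {ffun J -> bool} tau M_ramsey fS taua.
have [p [e eE]] := finite_set_range fS; have [q [d dE]] := finite_set_range fD.
have [D' _ D'P] := @ramsey_aut _ _ S _
  {ffun J * {ffun 'I_p -> 'I_q} -> bool} tau M_ramsey fS taua.
(* Through the enumerations [e] of [S] and [d] of [D], [w.2] codes a restriction to [S] with values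
   in [D]. By locality all [s] with the same code give the same truth value. *)
pose c1 r : {ffun J * {ffun 'I_p -> 'I_q} -> bool} := [ffun w : J * {ffun 'I_p -> 'I_q} =>
  `[< exists2 s, forall i, s (e i) = d (w.2 i) & test w.1 s r >]].
have [|r [ra _ rP]] := D'P c1.
  move=> s s' _ _ ss'; apply/ffunP => w; rewrite !ffunE; apply: asbool_equiv_eq.
  by split=> -[t tw tP]; exists t => //; apply: testP tP => //; apply: agree_sym.
pose c0 s : {ffun J -> bool} := [ffun j => `[< test j s r >]].
have [|s [sa sD sP]] := DP c0.
  move=> s s' _ _ ss'; apply/ffunP => w; rewrite !ffunE; apply: asbool_equiv_eq.
  by split; apply: testP => //; apply: agree_sym.
exists (s, r) => j; split=> //=.
(* [u] is the code of the chosen [s], so [c1] at [(j, finfun u)] is the truth value of [test j s]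
   and is unchanged by [tau j]. *)
- have /choice[u uP] i : exists k, d k = s (e i).
    have : D (s (e i)) by apply: sD; rewrite eE; exists i.
    by rewrite dE => -[k _ <-]; exists k.
  have c1P t : c1 t (j, finfun u) = `[< test j s t >].
    rewrite ffunE; apply: asbool_equiv_eq; split=> [[s' s'P] /=|]; last first.
      by exists s => // i; rewrite ffunE uP.
    apply: testP => // x; rewrite eE => -[i _ <-].
    by rewrite s'P ffunE uP.
  by apply: asbool_eq_equiv; rewrite -[LHS]c1P -[RHS]c1P rP.
- apply: asbool_eq_equiv.
  by have := congr1 (fun f : {ffun J -> bool} => f j) (sP j); rewrite !ffunE.
Qed.

(** By [finite_absorption] these sets have the finite intersection property, so one ultrafilter
    contains them all. *)
Lemma absorbing_ultrafilter :
  exists2 U : set_system ((M -> M) * (M -> M)), UltraFilter U &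
    forall test tau, local test -> aut tau -> U [set p | absorbs test tau p].
Proof.
pose D := [set X | exists test tau,
  [/\ local test, aut tau & X = [set p | absorbs test tau p]]].
have fin : finI D id.
  move=> F FD.
  have /choice[test testP] (X : F) : exists test, exists2 tau, aut tau &
      local test /\ val X = [set p | absorbs test tau p].
    by have /set_mem[test [tau [tl ta XE]]] := FD _ (valP X); exists test, tau.
  have /choice[tau tauP] (X : F) : exists tau, [/\ aut tau,
      local (test X) & val X = [set p | absorbs (test X) tau p]].
    by have [tau ta [tl XE]] := testP X; exists tau.
  have [p pP] := @finite_absorption _ test tau (fun X => let: And3 _ h _ := tauP X in h)
    (fun X => let: And3 h _ _ := tauP X in h).
  exists p => X XF; have [_ _ /= ->] := tauP [` XF]%fset; exact: pP.
have [U [UU FU]] := ultraFilterLemma (finI_filter fin).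
exists U => // test tau tl ta; apply: FU.
exists [set p | absorbs test tau p] => //.
by apply: finI_from1; exists test, tau.
Qed.

End TwoAutomorphisms.

(** * Countability of terms and formulas *)

Lemma inj_countable (T : Type) (U : countType) (f : T -> U) :
  injective f -> countable [set: T].
Proof.
move=> f_inj; apply/countable_injP; exists (choice.pickle \o f) => x y _ _.
by move/(pcan_inj choice.pickleK)/f_inj.
Qed.

Lemma countable_inj_nat (T : Type) :
  countable [set: T] -> exists f : T -> nat, injective f.
Proof.
by move=> /countable_injP[f f_inj]; exists f => x y; apply: f_inj; rewrite inE.
Qed.

Section Countability.
Variable L : language.

Section Codes.
Variables (cF : Defs.Fun L -> nat) (cR : Rel L -> nat).
Hypotheses (cF_inj : injective cF) (cR_inj : injective cR).

Fixpoint term_code n (t : term L n) : GenTree.tree nat :=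
  match t with
  | Var i => GenTree.Leaf (i : nat)
  | App f ts => GenTree.Node (cF f) [seq term_code (ts i) | i <- enum 'I_(fun_arity f)]
  end.

Lemma term_code_inj n : injective (@term_code n).
Proof.
elim=> [i|f ts IH] [j|f' ts'] //=; first by case=> /val_inj ->.
case=> /cF_inj ff'; case: _ / ff' in ts' * => /eq_in_map E.
by congr App; apply/funext => i; apply/IH/E; rewrite mem_enum.
Qed.

(** The number of free variables is not recorded: injectivity is stated for fixed [n], which
    determines it in all subformulas. *)
Fixpoint formula_code n (phi : formula L n) : GenTree.tree nat :=
  match phi with
  | Bot _ => GenTree.Leaf 0
  | Eq _ t u => GenTree.Node 0 [:: term_code t; term_code u]
  | Atom _ r ts =>
      GenTree.Node 1
        (GenTree.Leaf (cR r) :: [seq term_code (ts i) | i <- enum 'I_(rel_arity r)])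
  | Imp _ p q => GenTree.Node 2 [:: formula_code p; formula_code q]
  | Forall _ p => GenTree.Node 3 [:: formula_code p]
  end.

Lemma formula_code_inj n : injective (@formula_code n).
Proof.
elim=> {n} [n|n t u|n r ts|n p IHp q IHq|n p IHp] psi.
- by case: psi.
- by move: t u; case: n / psi => //= n t' u' t u [/term_code_inj -> /term_code_inj ->].
- move: ts; case: n / psi => //= n r' ts' ts [/cR_inj rr'].
  case: _ / rr' in ts' * => /eq_in_map E.
  by congr Atom; apply/funext => i; apply/term_code_inj/E; rewrite mem_enum.
- by move: p q IHp IHq; case: n / psi => //= n p' q' p q IHp IHq [/IHp -> /IHq ->].
- by move: p IHp; case: n / psi => //= n p' p IHp [/IHp ->].
Qed.

End Codes.

Lemma countable_term n : countable [set: Defs.Fun L] -> countable [set: term L n].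
Proof. by move=> /countable_inj_nat[cF /term_code_inj/(_ n)/inj_countable]. Qed.

End Countability.

(** * Skolem terms and a countable elementary part of an ultrapower *)

Lemma quotient_exists (T : Type) (R : T -> T -> Prop) :
  (forall x, R x x) -> (forall x y, R x y -> R y x) ->
  (forall x y z, R x y -> R y z -> R x z) ->
  exists (Q : Type) (pi : T -> Q) (rho : Q -> T),
    cancel rho pi /\ forall x y, pi x = pi y <-> R x y.
Proof.
move=> Rxx Rsym Rtr; pose Q : set (set T) := range R.
have piP x : R x \in Q by rewrite inE; exists x.
have /choice[rho rhoP] (q : Q) : exists x, R x = val q.
  by have [x _ <-] := set_valP q; exists x.
exists Q, (fun x => SigSub (piP x)), rho; split=> [q|x y].
  by apply: val_inj; rewrite /= rhoP.
split=> [/(congr1 val)/= E|Rxy]; first by rewrite E.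
apply: val_inj => /=; apply/funext => z; apply/propext.
by split; apply: Rtr => //; apply: Rsym.
Qed.

Section SkolemHull.
Variables (L : language) (C : Type).

(** [Witness phi] is meant to name, as a function of the free variables, a counterexample to
    [Forall phi]. *)
Inductive skolem_symbol : Type :=
| Const of C
| Old of Defs.Fun L
| Witness n of formula L n.+1.

Definition skolem_arity (s : skolem_symbol) : nat :=
  match s with Const _ => 0 | Old f => fun_arity f | Witness n _ => n end.

Definition skolem_language : language :=
  @Language skolem_symbol void skolem_arity (of_void nat).

Lemma countable_skolem_symbol : countable_language L -> countable [set: C] ->
  countable [set: skolem_symbol].
Proof.
move=> [/countable_inj_nat[cF cF_inj] /countable_inj_nat[cR cR_inj]].
move=> /countable_inj_nat[cC cC_inj].
pose code (s : skolem_symbol) : nat * GenTree.tree nat :=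
  match s with
  | Const c => (0, GenTree.Leaf (cC c))
  | Old f => (1, GenTree.Leaf (cF f))
  | Witness n phi => (n.+2, formula_code cF cR phi)
  end.
apply: (@inj_countable _ _ code) => -[c|f|n phi] [c'|f'|n' phi'] //=.
- by case=> /cC_inj ->.
- by case=> /cF_inj ->.
- by case=> nn'; case: _ / nn' in phi' * => /(formula_code_inj cF_inj cR_inj) ->.
Qed.

Variables (M : structure L) (witness : forall n, formula L n.+1 -> ('I_n -> M) -> M).

Definition skolem_structure (a : C -> M) : structure skolem_language :=
  @Structure skolem_language M
    (fun s => match s return ('I_(skolem_arity s) -> M) -> M with
              | Const c => fun=> a c
              | Old f => @fun_interp L M f
              | Witness n phi => @witness n phi
              end)
    (fun r _ => False).

End SkolemHull.

Lemma ultra_imp T (U : set_system T) (A B : set T) : UltraFilter U ->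
  U [set p | A p -> B p] <-> (U A -> U B).
Proof.
move=> UU; split=> [AB UA|AB]; first by apply: filterS2 AB UA => p; apply.
have [/AB|] := in_ultra_setVsetC A UU; apply: filterS => p //=.
Qed.

(* Terms built from the constants by Skolem functions, evaluated coordinatewise and
   identified U-almost everywhere, form a countable elementary substructure of the
   ultrapower that contains the sequences [fun p => a p c]. *)
Lemma countable_ultrapower (L : language) (M : structure L) (C P : Type)
    (U : set_system P) (a : P -> C -> M) (x0 : M) :
  countable_language L -> countable [set: C] -> UltraFilter U ->
  exists (N : structure L) (g : C -> N), countable [set: N] /\
    forall n (phi : formula L n) (v : 'I_n -> C),
      sat phi (g \o v) <-> U [set p | sat phi (a p \o v)].
Proof.
move=> cL cC UU.
(* The witness is a counterexample if there is one and [x0] otherwise, so truth at the witness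
   implies truth everywhere. *)
have /choice[w' w'P] (x : {n & (formula L n.+1 * ('I_n -> M))%type}) :
    exists y, sat (projT2 x).1 (vcons y (projT2 x).2) ->
      forall z, sat (projT2 x).1 (vcons z (projT2 x).2).
  case: x => n [phi v] /=; have [[y ny]|ny] := pselect (exists y, ~ sat phi (vcons y v)).
    by exists y => /ny.
  by exists x0 => _ z; apply: contrapT => nz; apply: ny; exists z.
pose w n phi v := w' (existT _ n (phi, v)).
have wP n (phi : formula L n.+1) v : sat phi (vcons (w n phi v) v) ->
    forall z, sat phi (vcons z v) by exact: (w'P (existT _ n (phi, v))).
pose T := term (skolem_language L C) 0.
pose ev p (t : T) : M := @eval _ (skolem_structure w (a p)) 0 (@vnil _) t.
have [|||Q [pi [rho [rhoK piE]]]] := @quotient_exists T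
    (fun s t => U [set p | ev p s = ev p t]).
- by move=> t; apply: filterS filterT => p.
- by move=> s t; apply: filterS => p.
- by move=> s t u; apply: filterS2 => p /= -> ->.
have rhoE n (v : 'I_n -> T) : U [set p | forall i, ev p (rho (pi (v i))) = ev p (v i)].
  by apply: filter_forall => i; apply/piE; rewrite rhoK.
pose N := @Structure L Q
  (fun f v => pi (@App (skolem_language L C) 0 (Old C f) (fun i => rho (v i))))
  (fun r v => U [set p | rel_interp (r := r) (fun i => ev p (rho (v i)))]).
(* An [L]-term evaluated in [N] at classes is the class of a single Skolem term, computed
   coordinatewise. *)
have evalE n (v : 'I_n -> T) (t : term L n) : exists t' : T,
    @eval L N n (pi \o v) t = pi t' /\ forall p, ev p t' = eval (ev p \o v) t.
  elim: t => [i|f ts /choice[ts' tsE]]; first by exists (v i).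
  exists (@App (skolem_language L C) 0 (Old C f) ts'); split=> [/=|p].
    rewrite (_ : (fun i => _) = fun i => rho (pi (ts' i))); last first.
      by apply/funext => i; rewrite (tsE i).1.
    apply/piE; apply: filterS (rhoE _ ts') => p H.
    by rewrite /ev /=; congr fun_interp; apply/funext => i; apply: H.
  by rewrite /ev /=; congr fun_interp; apply/funext => i; apply: (tsE i).2.
(* The theorem of Los for [N], by induction on formulas. *)
have los n (phi : formula L n) (v : 'I_n -> T) :
    @sat L N n phi (pi \o v) <-> U [set p | sat phi (ev p \o v)].
  elim: phi v => {n} [n|n t u|n r ts|n phi IHphi psi IHpsi|n phi IHphi] v /=.
  - by split=> //; apply: filter_not_empty.
  - have [t' [-> tE]] := evalE n v t; have [u' [-> uE]] := evalE n v u.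
    rewrite piE; suff -> : (fun p => ev p t' = ev p u') =
      (fun p => eval (ev p \o v) t = eval (ev p \o v) u) by [].
    by apply/funext => p; rewrite tE uE.
  - have /choice[ts' tsE] i := evalE n v (ts i).
    have E p : (forall i, ev p (rho (pi (ts' i))) = ev p (ts' i)) ->
        (fun i => ev p (rho (@eval L N n (pi \o v) (ts i)))) =
        (fun i => eval (ev p \o v) (ts i)).
      by move=> H; apply/funext => i; rewrite (tsE i).1 H (tsE i).2.
    by split; apply: filterS2 (rhoE _ ts') => p /E /= ->.
  - by rewrite IHphi IHpsi -ultra_imp.
  - have vconsE p t : ev p \o vcons t v = vcons (ev p t) (ev p \o v) by rewrite comp_vcons.
    split=> [H|H q]; last first.
      rewrite -(rhoK q) -comp_vcons; apply/IHphi; apply: filterS H => p.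
      by rewrite /= vconsE; apply.
    (* Instantiating at the class of the Skolem witness gives truth at a potential counterexample in
       almost every coordinate. *)
    have := H (pi (@App (skolem_language L C) 0 (Witness C phi) v)).
    rewrite -comp_vcons => /IHphi; apply: filterS => p /=.
    by rewrite vconsE => /wP.
pose g c : Q := pi (@App (skolem_language L C) 0 (Const L c) (@vnil _)).
exists N, g; split.
  have /countable_inj_nat[c c_inj] := countable_term (L := skolem_language L C) 0
    (countable_skolem_symbol cL cC).
  by apply: (@inj_countable _ _ (c \o rho)); apply: inj_comp (can_inj rhoK).
move=> n phi v.
by apply: (los n phi (fun i => @App (skolem_language L C) 0 (Const L (v i)) (@vnil _))).
Qed.

(** * Elementary maps and nonsplitting *)

Section Main.
Variables (L : language) (M : structure L).

Definition elementary (J : M -> M) : Prop :=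
  forall n (phi : formula L n) (v : 'I_n -> M), sat phi (J \o v) <-> sat phi v.

Lemma elementary_embedding J : elementary J -> embedding J.
Proof.
move=> Je; split.
- move=> x y.
  have := Je _ (Eq (Var L (ord0 : 'I_2)) (Var L (lift ord0 ord0))) (vcons x (vcons y vnil)).
  by rewrite /= /vcons /= unlift_none liftK unlift_none => <-.
- move=> f v; have := Je _ (Eq (App (fun i => Var L (lift ord0 i))) (Var L ord0))
    (vcons (fun_interp (f := f) v) v).
  have vE w x : (fun i : 'I_(fun_arity f) => @vcons M _ x w (lift ord0 i)) = w.
    by apply/funext => i; rewrite /vcons liftK.
  rewrite comp_vcons /= !vE /vcons unlift_none => H.
  by have /H : fun_interp v = fun_interp v by [].
- by move=> r v; apply: iff_sym; apply: (Je _ (Atom (fun i : 'I_(rel_arity r) => Var L i)) v).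
Qed.

(** Elementarity of [J'] pulls equality of types back to [M], where the two tuples are conjugate by
    some [tau]; the invariance hypothesis then handles parameters from [range J]. *)
Lemma nonsplit_ranges (J J' : M -> M) :
  ultrahomogeneous M -> (forall N, age M N -> finite_set [set: N]) -> elementary J' ->
  (forall m n (phi : formula L (m + n)) (alpha : 'I_m -> M) (beta : 'I_n -> M) tau, aut tau ->
     sat phi (vcat (J \o alpha) (J' \o (tau \o beta))) <->
     sat phi (vcat (J \o alpha) (J' \o beta))) ->
  nonsplit (range J) (range J').
Proof.
move=> hom fage Je' inv n b b' bJ bJ' bb'.
have factor k (K : M -> M) (w : 'I_k -> M) : (forall i, range K (w i)) -> exists u, w = K \o u.
  move=> wK; have /choice[u uE] i : exists x, K x = w i by have [x _] := wK i; exists x.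
  by exists u; apply/funext => i /=.
have [beta bE] := factor _ _ _ bJ; have [beta' bE'] := factor _ _ _ bJ'.
have [tau ta tauE] : exists2 s, aut s & s \o beta = beta'.
  apply: tp_aut => // phi.
  by rewrite -Je' -(Je' _ _ beta') -bE -bE'; apply: tp_set0_sat.
rewrite bE bE' -tauE; apply/funext => -[m [c phi]]; apply/propext; rewrite /tp /=.
have [alpha ->] := factor _ J (fun i => val (c i)) (fun i => set_valP (c i)).
by rewrite inv.
Qed.

Lemma local_sat (m n : nat) (phi : formula L (m + n)) (alpha : 'I_m -> M) (beta : 'I_n -> M) :
  local (fun s r => sat phi (vcat (s \o alpha) (r \o beta))) /\
  local (fun s r => sat phi (vcat (r \o alpha) (s \o beta))).
Proof.
have fS : finite_set (range alpha `|` range beta).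
  by rewrite finite_setU; split; apply: finite_image; apply: finite_finset.
have alphaE (s s' : M -> M) :
    agree (range alpha `|` range beta) s s' -> s \o alpha = s' \o alpha.
  by move=> ss'; apply/funext => i; apply: ss'; left; exists i.
have betaE (s s' : M -> M) :
    agree (range alpha `|` range beta) s s' -> s \o beta = s' \o beta.
  by move=> ss'; apply/funext => i; apply: ss'; right; exists i.
split; exists (range alpha `|` range beta) => // s s' r r' ss' rr'.
- by rewrite (alphaE _ _ ss') (betaE _ _ rr').
- by rewrite (alphaE _ _ rr') (betaE _ _ ss').
Qed.

End Main.

Lemma nonsplit_models (L : language) (M : structure L) :
  countable_language L -> countable [set: M] -> omega_categorical M -> ramsey_structure M ->
  exists J0 J1 : M -> M, [/\ embedding J0, embedding J1,
    nonsplit (range J0) (range J1) & nonsplit (range J1) (range J0)].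
Proof.
move=> cL cM cat ram; have [hom _ [fage _]] := ram.
(* The carrier may be empty, leaving no default [x0]; then any two tuples of the same length are
   equal. *)
have [[x0]|M0] := pselect (exists x : M, True); last first.
  have eid : embedding (@id M) by have [] := isomorphism_id M.
  have ns (A B : set M) : nonsplit A B.
    move=> n b b' _ _ _; congr tp; apply/funext => i.
    by case: M0; exists (b i).
  by exists id, id; split.
move=> _; have [U UU UP] := absorbing_ultrafilter ram.
have cMM : countable [set: M + M].
  have /countable_inj_nat[c c_inj] := cM.
  pose d (x : M + M) := match x with inl y => (true, c y) | inr y => (false, c y) end.
  by apply: (@inj_countable _ _ d) => -[x|x] [y|y] // [/c_inj ->].
(* The two summands carry the two automorphisms of a pair, so formulas can mix values of both. *)
pose a (p : (M -> M) * (M -> M)) (x : M + M) :=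
  match x with inl y => p.1 y | inr y => p.2 y end.
have [N [g [cN gP]]] := countable_ultrapower a x0 cL cMM UU.
(* The truth of a sentence does not depend on [p], so [N] is elementarily equivalent to [M]. *)
have [h ih] : isomorphic N M.
  apply: cat => // phi.
  have := gP 0 phi vnil; rewrite (_ : g \o vnil = vnil); last by apply/funext => -[].
  move=> ->; split=> [Uphi|phiM].
    have [p] := filter_ex Uphi.
    by rewrite /= (_ : a p \o vnil = vnil) //; apply/funext => -[].
  apply: filterS filterT => p _ /=.
  by rewrite (_ : a p \o vnil = vnil) //; apply/funext => -[].
have hgP n (phi : formula L n) v : sat phi (h \o g \o v) <-> U [set p | sat phi (a p \o v)].
  by rewrite -gP (sat_isomorphism _ _ ih).
(* The trivial test extracts from [absorbs] that almost every pair consists of automorphisms. *)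
have Uaut : U [set p | aut p.1 /\ aut p.2].
  have lT : local (fun _ _ : M -> M => True) by exists set0.
  by apply: filterS (UP _ _ lT (isomorphism_id M)) => p [].
have el0 : elementary (h \o g \o inl).
  move=> n phi v; rewrite -[_ \o v]/(h \o g \o (inl \o v)) hgP; split=> H.
    have [p [[p1 _]]] := filter_ex (filterI Uaut H).
    by rewrite /= -[_ \o _]/(p.1 \o v) -sat_aut.
  by apply: filterS Uaut => p [p1 _]; rewrite /= -[_ \o _]/(p.1 \o v) -sat_aut.
have el1 : elementary (h \o g \o inr).
  move=> n phi v; rewrite -[_ \o v]/(h \o g \o (inr \o v)) hgP; split=> H.
    have [p [[_ p2]]] := filter_ex (filterI Uaut H).
    by rewrite /= -[_ \o _]/(p.2 \o v) -sat_aut.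
  by apply: filterS Uaut => p [_ p2]; rewrite /= -[_ \o _]/(p.2 \o v) -sat_aut.
have UE (A B : set ((M -> M) * (M -> M))) : U [set p | A p <-> B p] -> U A <-> U B.
  by move=> AB; split; apply: filterS2 AB => p [].
exists (h \o g \o inl), (h \o g \o inr); split.
- exact: elementary_embedding.
- exact: elementary_embedding.
(* Here the parameters come from [p.1] and [tau] acts on the side of [p.2]; in the next case the
   roles are exchanged. *)
- apply: nonsplit_ranges => // m n phi alpha beta tau ta.
  rewrite -[vcat _ _](comp_vcat (h \o g) (inl \o alpha) (inr \o (tau \o beta))).
  rewrite -[X in _ <-> sat _ X](comp_vcat (h \o g) (inl \o alpha) (inr \o beta)) !hgP.
  apply: UE; have [l _] := local_sat phi alpha beta.
  by apply: filterS (UP _ _ l ta) => p [_ _ + _]; rewrite /= !comp_vcat.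
- apply: nonsplit_ranges => // m n phi alpha beta tau ta.
  rewrite -[vcat _ _](comp_vcat (h \o g) (inr \o alpha) (inl \o (tau \o beta))).
  rewrite -[X in _ <-> sat _ X](comp_vcat (h \o g) (inr \o alpha) (inl \o beta)) !hgP.
  apply: UE; have [_ l] := local_sat phi alpha beta.
  by apply: filterS (UP _ _ l ta) => p [_ _ _]; rewrite /= !comp_vcat.
Qed.

Theorem proposition3p17 (L : language) (M : structure L)
    (L_countable : countable_language L)
    (M_countable : countable [set: M])
    (M_omega_cat : omega_categorical M)
    (M_ramsey : ramsey_structure M) :
  exists M0 M1 : substructure M,
    [/\ isomorphic (induced M0) M, isomorphic (induced M1) M,
        nonsplit M0 M1 & nonsplit M1 M0].
Proof.
have [J0 [J1 [e0 e1 ns01 ns10]]] :=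
  nonsplit_models L_countable M_countable M_omega_cat M_ramsey.
have [M0 M0E [h0 ih0 _]] := embedding_range e0.
have [M1 M1E [h1 ih1 _]] := embedding_range e1.
have [g0 [ig0 _ _]] := isomorphism_inv ih0.
have [g1 [ig1 _ _]] := isomorphism_inv ih1.
by exists M0, M1; split; [exists g0|exists g1|rewrite M0E M1E|rewrite M0E M1E].
Qed.
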